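(* Let $f,g\in\mathbf{Q}[t]$ be non-zero coprime polynomials of degrees $r$ and $s$, with at least one of $r,s$ positive, and write $\max(r/4,s/6)=n/m$ with $n,m$ coprime positive integers. Assume $n=1$ or $m=1$. Let $\mathcal{E}$ be the family of elliptic curves $y^2=x^3+f(t)x+g(t)$, and let $N(X)$ be the number of isomorphism classes of elliptic curves $E/\mathbf{Q}$ of height at most $X$ for which $E\cong\mathcal{E}_t$ for some $t\in\mathbf{Q}$ (with $\mathcal{E}_t$ an elliptic curve). Then there exist positive constants $K_1,K_2$ such that $K_1X^{(m+1)/12n}\le N(X)\le K_2X^{(m+1)/12n}$ for all $X\ge1$.
   Context: Every elliptic curve $E/\mathbf{Q}$ has a unique equation $y^2=x^3+Ax+B$ with $A,B\in\mathbf{Z}$ such that $\gcd(A^3,B^2)$ is not divisible by $d^{12}$ for any integer $d>1$; the height of $E$ is $\max(|A|^3,|B|^2)$. $\mathcal{E}_t$ denotes the curve $y^2=x^3+f(t)x+g(t)$ over $\mathbf{Q}$ for $t\in\mathbf{Q}$.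
   Formalization: The lower bound for all X≥1 fails when N(1)=0 (e.g. f=2, g=t, where N(X)=0 for X<8); proved instead: there is X0≥1 with N(X)=0 for 1≤X<X0 and both bounds for all X≥X0. *)

(* Defs.v *)
From mathcomp Require Import all_boot all_order all_algebra.
From mathcomp Require Import finmap.
From mathcomp Require Import all_classical all_reals all_analysis.

Set Implicit Arguments.
Unset Strict Implicit.
Unset Printing Implicit Defensive.

Import Order.TTheory GRing.Theory Num.Theory.

Local Open Scope ring_scope.
Local Open Scope classical_set_scope.

(* y^2 + a1 x y + a3 y = x^3 + a2 x^2 + a4 x + a6 over Q *)
Record weierstrass := Weierstrass
  { a1 : rat; a2 : rat; a3 : rat; a4 : rat; a6 : rat }.

Definition weierstrass_eq (E : weierstrass) (x y : rat) : rat :=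
  y ^+ 2 + a1 E * x * y + a3 E * y
    - (x ^+ 3 + a2 E * x ^+ 2 + a4 E * x + a6 E).

Definition b2 (E : weierstrass) : rat := a1 E ^+ 2 + 4 * a2 E.
Definition b4 (E : weierstrass) : rat := 2 * a4 E + a1 E * a3 E.
Definition b6 (E : weierstrass) : rat := a3 E ^+ 2 + 4 * a6 E.
Definition b8 (E : weierstrass) : rat :=
  a1 E ^+ 2 * a6 E + 4 * a2 E * a6 E - a1 E * a3 E * a4 E
    + a2 E * a3 E ^+ 2 - a4 E ^+ 2.

Definition discriminant (E : weierstrass) : rat :=
  - b2 E ^+ 2 * b8 E - 8 * b4 E ^+ 3 - 27 * b6 E ^+ 2
    + 9 * b2 E * b4 E * b6 E.

Definition elliptic (E : weierstrass) : Prop := discriminant E != 0.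

(* Isomorphisms over Q of elliptic curves given by Weierstrass equations are
   the substitutions x = u^2 x' + r, y = u^3 y' + s u^2 x' + t.  As Q is
   infinite, equality at all rational points is equality of polynomials. *)
Definition isomorphic (E E' : weierstrass) : Prop :=
  exists u r s t : rat, u != 0 /\
    forall x y : rat,
      weierstrass_eq E (u ^+ 2 * x + r) (u ^+ 3 * y + s * u ^+ 2 * x + t)
        = u ^+ 6 * weierstrass_eq E' x y.

Definition iso_class (E : weierstrass) : set weierstrass :=
  [set E' | isomorphic E E'].

Definition short_weierstrass (A B : rat) : weierstrass :=
  Weierstrass 0 0 0 A B.

Definition minimal_equation (E : weierstrass) (A B : int) : Prop :=
  (forall d : int, 1 < d -> ~~ (d ^+ 12 %| gcdz (A ^+ 3) (B ^+ 2))%Z) /\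
  isomorphic E (short_weierstrass A%:~R B%:~R).

(* (A, B) is determined by E, so this relation is a function of E. *)
Definition has_height (E : weierstrass) (h : int) : Prop :=
  exists A B : int,
    minimal_equation E A B /\ h = Num.max (`|A| ^+ 3) (`|B| ^+ 2).

Definition family (f g : {poly rat}) (t : rat) : weierstrass :=
  short_weierstrass f.[t] g.[t].

Definition family_classes (R : realType) (f g : {poly rat}) (X : R) :
    set (set weierstrass) :=
  [set C | exists E : weierstrass,
    [/\ elliptic E, C = iso_class E,
        exists2 h : int, has_height E h & h%:~R <= X
      & exists2 t : rat, elliptic (family f g t)
                       & isomorphic E (family f g t)]].

(* This set is always finite: finitely many pairs (A, B) have height at
   most X.  (fset_set would send an infinite set to the empty one.) *)
Definition family_count (R : realType) (f g : {poly rat}) (X : R) : nat :=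
  #|` fset_set (family_classes f g X) |.

(* Main.v *)
Require Import Defs.
From mathcomp Require Import all_boot all_order all_algebra.
From mathcomp Require Import finmap.
From mathcomp Require Import all_classical all_reals all_analysis.
From mathcomp Require Import ring lra zify.

Import Order.TTheory GRing.Theory Num.Theory.
(* Imported again so that [family] is not the one of [finfun]. *)
Import Defs.
Local Open Scope ring_scope.

(** Every [t] whose curve has a minimal model [A = u ^ 4 f(t)],
    [B = u ^ 6 g(t)] of height at most [X] has the form [a / w ^ m] with
    [|w| ^ n <= C |u|]: a Bezout identity for [f] and [g] bounds the common
    factors of their homogenizations, hence the denominators ([n = 1] or
    [m = 1] makes [w] an integer).  Since
    [|f(t)| ^ 3m + |g(t)| ^ 2m >= c max(1, |t|) ^ 12n], this forces
    [|w| <= C' Y] and [|a| <= C' Y ^ m], where [Y = X ^ (1 / 12n)], which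
    leaves [O(Y ^ (m + 1))] parameters.  Conversely the fractions [a / w ^ m]
    with [w <= Z], [a <= Z ^ m] and [gcd(a, w) = 1] are at least
    [Z ^ (m + 1) / 4] in number, give curves of height [O(Z ^ 12n)], and at
    most [k] of them are isomorphic to a given curve, because
    [f(t) ^ 3 g(t') ^ 2 = g(t) ^ 2 f(t') ^ 3] is a non-trivial polynomial
    equation in [t']. *)

Local Notation ratpoly := (map_poly (intr : int -> rat)).

(** * Isomorphisms of short Weierstrass equations *)

Lemma isomorphic_refl E : isomorphic E E.
Proof.
exists 1, 0, 0, 0; split=> [|x y]; first exact: oner_neq0.
by rewrite !(expr1n, mul1r, mul0r, addr0).
Qed.

Lemma isomorphic_trans E1 E2 E3 :
  isomorphic E1 E2 -> isomorphic E2 E3 -> isomorphic E1 E3.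
Proof.
move=> [u [r [s [t [u0 h]]]]] [u' [r' [s' [t' [u'0 h']]]]].
exists (u * u'), (u ^+ 2 * r' + r), (u * s' + s), (u ^+ 3 * t' + s * u ^+ 2 * r' + t).
split=> [|x y]; first exact: mulf_neq0.
rewrite [RHS](_ : _ = u ^+ 6 * (u' ^+ 6 * weierstrass_eq E3 x y)); last by rewrite exprMn mulrA.
by rewrite -h' -h; congr weierstrass_eq; ring.
Qed.

Lemma isomorphic_sym E1 E2 : isomorphic E1 E2 -> isomorphic E2 E1.
Proof.
move=> [u [r [s [t [u0 h]]]]].
exists u^-1, (- r / u ^+ 2), (- s / u), ((s * r - t) / u ^+ 3).
split=> [|x y]; first exact: invr_neq0.
apply: (mulfI (expf_neq0 6 u0)); rewrite -h [RHS]mulrA -[in RHS]exprMn mulfV // expr1n mul1r.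
by congr weierstrass_eq; field.
Qed.

Lemma iso_class_eq E1 E2 : isomorphic E1 E2 -> iso_class E1 = iso_class E2.
Proof.
move=> h; apply/seteqP; split=> E /=; rewrite /iso_class /=.
  exact/isomorphic_trans/isomorphic_sym.
exact: isomorphic_trans.
Qed.

Lemma iso_class_inj E1 E2 : iso_class E1 = iso_class E2 -> isomorphic E1 E2.
Proof.
move=> h; suff : iso_class E1 E2 by [].
by rewrite h; exact: isomorphic_refl.
Qed.

Lemma isomorphic_shortP A B A' B' :
  isomorphic (short_weierstrass A B) (short_weierstrass A' B') <->
  exists2 u : rat, u != 0 & A = u ^+ 4 * A' /\ B = u ^+ 6 * B'.
Proof.
split=> [[u [r [s [t [u0 h]]]]]|[u u0 [-> ->]]]; last first.
  exists u, 0, 0, 0; split=> // x y.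
  by rewrite /weierstrass_eq /=; ring.
have u3 : u ^+ 3 != 0 by apply: expf_neq0.
have u4 : u ^+ 4 != 0 by apply: expf_neq0.
have u5 : u ^+ 5 != 0 by apply: expf_neq0.
have u2 : u ^+ 2 != 0 by apply: expf_neq0.
rewrite /weierstrass_eq /= in h.
(* Combining values at a few points isolates the coefficients of [y], [x y] and [x ^ 2], which are
   in turn [2 u ^ 3 t], [2 u ^ 5 s] and [-3 u ^ 4 r]. *)
have t0 : t = 0.
  apply: (mulfI u3); rewrite mulr0.
  have := h 0 1; have := h 0 (-1); rewrite !(mul0r, mulr0, addr0, add0r).
  lra.
have s0 : s = 0.
  apply: (mulfI u5); rewrite mulr0; subst t.
  have := h 1 1; have := h 1 (-1); rewrite !(mul0r, mulr0, addr0, add0r, mulr1, expr1n).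
  move=> h1 h2; lra.
have r0 : r = 0.
  apply: (mulfI u4); rewrite mulr0; subst t s.
  have := h 1 0; have := h (-1) 0; have := h 0 0.
  rewrite !(mul0r, mulr0, addr0, add0r, mulr1, expr1n).
  move=> h1 h2 h3; lra.
subst.
have hB : B = u ^+ 6 * B'.
  have := h 0 0; rewrite !(mul0r, mulr0, addr0, add0r, mulr1, expr1n); lra.
exists u => //; split => //.
apply: (mulfI u2); have := h 1 0.
rewrite hB !(mul0r, mulr0, addr0, add0r, mulr1, expr1n); lra.
Qed.

Lemma elliptic_shortE A B :
  elliptic (short_weierstrass A B) <-> 4 * A ^+ 3 + 27 * B ^+ 2 != 0.
Proof.
rewrite /elliptic.
have -> : discriminant (short_weierstrass A B) = - 16 * (4 * A ^+ 3 + 27 * B ^+ 2).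
  by rewrite /discriminant /b2 /b4 /b6 /b8 /=; ring.
by rewrite mulf_eq0.
Qed.

Lemma has_height_isomorphic E E' h :
  isomorphic E E' -> has_height E h -> has_height E' h.
Proof.
move=> i [A [B [[hm hi] ->]]]; exists A, B; split=> //; split=> //.
exact/isomorphic_trans/hi/isomorphic_sym.
Qed.

Lemma elliptic_isomorphic_short A B A' B' :
  isomorphic (short_weierstrass A B) (short_weierstrass A' B') ->
  elliptic (short_weierstrass A B) -> elliptic (short_weierstrass A' B').
Proof.
move=> /isomorphic_shortP [u u0 [-> ->]] /elliptic_shortE h.
apply/elliptic_shortE; apply: contra_neq h => h.
have -> : 4 * (u ^+ 4 * A') ^+ 3 + 27 * (u ^+ 6 * B') ^+ 2 =
  u ^+ 12 * (4 * A' ^+ 3 + 27 * B' ^+ 2) by ring.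
by rewrite h mulr0.
Qed.

(** * Parameters of bounded height *)

(** Heights are integers, so a natural number bound, the truncation of [X], is enough. *)
Definition good_param (f g : {poly rat}) (H : nat) (t : rat) : Prop :=
  elliptic (family f g t) /\
  exists2 h : int, has_height (family f g t) h & (h <= H%:Z).

Lemma int_le_trunc (R : realType) (h : int) (X : R) : 0 <= X ->
  (h%:~R <= X) = (h <= (Num.truncn X)%:Z).
Proof.
move=> X0; case: h => h; first by rewrite -truncn_ge_nat.
rewrite NegzE.
have -> : - h.+1%:Z <= (Num.truncn X)%:Z by lia.
by apply: le_trans X0; rewrite mulrNz oppr_le0 ler0z.
Qed.

Lemma family_classesE (R : realType) (f g : {poly rat}) (X : R) : 0 <= X ->
  family_classes f g X =
  [set iso_class (family f g t) | t in good_param f g (Num.truncn X)]%classic.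
Proof.
move=> X0; apply/seteqP; split=> C /=.
  move=> [E [_ -> [h hE hX] [t et it]]]; exists t; last exact/esym/iso_class_eq.
  split=> //; exists h; first exact: has_height_isomorphic it hE.
  by rewrite -(int_le_trunc R).
move=> [t [et [h hE hX]] <-]; exists (family f g t); split=> //.
  by exists h => //; rewrite int_le_trunc.
by exists t => //; exact: isomorphic_refl.
Qed.

(** Each curve changes only by the substitution with [u = c]. This reduces the count to families
    with integral coefficients. *)
Lemma family_classes_scale (R : realType) (f g : {poly rat}) (X : R) (c : rat) :
  c != 0 -> family_classes (c ^+ 4 *: f) (c ^+ 6 *: g) X = family_classes f g X.
Proof.
move=> c0.
have iso t : isomorphic (family (c ^+ 4 *: f) (c ^+ 6 *: g) t) (family f g t).
  by apply/isomorphic_shortP; exists c => //; rewrite !hornerZ.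
apply/seteqP; split=> C /= [E [eE -> hh [t et it]]]; exists E; split=> //; exists t.
- exact: (elliptic_isomorphic_short _ _ _ _ (iso t) et).
- exact: (isomorphic_trans _ _ _ it (iso t)).
- exact: (elliptic_isomorphic_short _ _ _ _ (isomorphic_sym _ _ (iso t)) et).
- exact: (isomorphic_trans _ _ _ it (isomorphic_sym _ _ (iso t))).
Qed.

(** * Minimal models and integral coefficients *)

Lemma dvdz_pexp2r (k : nat) (d x : int) : (0 < k)%N ->
  (d ^+ k %| x ^+ k)%Z = (d %| x)%Z.
Proof. by move=> k0; rewrite !dvdzE !abszX dvdn_pexp2r. Qed.

(* Dividing by [d ^+ 4], [d ^+ 6] strictly decreases [`|A| + `|B|]. *)
Lemma minimal_model (A B : int) : (A != 0) || (B != 0) ->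
  exists A' B' : int,
    [/\ minimal_equation (short_weierstrass A%:~R B%:~R) A' B',
        `|A'| <= `|A| & `|B'| <= `|B|].
Proof.
have [k] := ubnP (`|A| + `|B|)%N; elim: k A B => // k IH A B hk AB.
have [[d [d1 dv]]|hmin] := pselect (exists d : int, 1 < d /\
  (d ^+ 12 %| gcdz (A ^+ 3) (B ^+ 2))%Z); last first.
  exists A, B; split=> //; split; last exact: isomorphic_refl.
  by move=> d d1; apply/negP => dv; apply: hmin; exists d.
move: dv; rewrite dvdz_gcd.
rewrite {1}(exprM d 4 3) (exprM d 6 2) !dvdz_pexp2r // => /andP[/dvdzP [A1 eA] /dvdzP [B1 eB]].
have d0 : d != 0 by lia.
have d4 : (2 <= `|d ^+ 4|)%N.
  rewrite abszX; apply: (@leq_trans (2 ^ 4)) => //; rewrite leq_exp2r //; lia.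
have d6 : (2 <= `|d ^+ 6|)%N.
  rewrite abszX; apply: (@leq_trans (2 ^ 6)) => //; rewrite leq_exp2r //; lia.
have AB1 : (A1 != 0) || (B1 != 0).
  by apply: contraTT AB; rewrite !negb_or !negbK eA eB => /andP[/eqP -> /eqP ->]; rewrite !mul0r.
have nA : `|A|%N = (`|A1| * `|d ^+ 4|)%N by rewrite eA abszM.
have nB : `|B|%N = (`|B1| * `|d ^+ 6|)%N by rewrite eB abszM.
have lA : (`|A1| <= `|A|)%N by rewrite nA leq_pmulr // (ltn_trans _ d4).
have lB : (`|B1| <= `|B|)%N by rewrite nB leq_pmulr // (ltn_trans _ d6).
have lAB : (`|A1| + `|B1| < `|A| + `|B|)%N.
  case/orP: AB1 => [A10|B10].
    have lA' : (`|A1| < `|A|)%N by rewrite nA ltn_Pmulr // absz_gt0.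
    exact: leq_add lA' lB.
  have lB' : (`|B1| < `|B|)%N by rewrite nB ltn_Pmulr // absz_gt0.
  by rewrite -addnS; exact: leq_add lA lB'.
have {}hk : (`|A1| + `|B1| < k)%N by apply: leq_trans lAB _; rewrite -ltnS.
have [A' [B' [[h1 h2] h3 h4]]] := IH A1 B1 hk AB1.
have le_abs (x y z : int) : `|x| <= `|y| -> (`|y| <= `|z|)%N -> `|x| <= `|z|.
  by move=> xy yz; apply: le_trans xy _; rewrite -!abszE lez_nat.
exists A', B'; split; [|exact: le_abs h3 lA|exact: le_abs h4 lB]; split=> //.
apply: isomorphic_trans h2.
apply/isomorphic_shortP; exists d%:~R; rewrite ?intr_eq0 //.
by rewrite eA eB; split; ring.
Qed.

Lemma clear_denominators (f g : {poly rat}) :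
  exists (c : rat) (F G : {poly int}),
    [/\ c != 0, c ^+ 4 *: f = ratpoly F & c ^+ 6 *: g = ratpoly G].
Proof.
have [F [a a0 ->]] := rat_poly_scale f; have [G [b b0 ->]] := rat_poly_scale g.
have aQ : a%:~R != 0 :> rat by rewrite intr_eq0.
have bQ : b%:~R != 0 :> rat by rewrite intr_eq0.
(* With [f = F / a] and [g = G / b], the single scalar [a * b] serves both weights 4 and 6. *)
exists (a * b)%:~R, (a ^+ 3 * b ^+ 4 *: F), (a ^+ 6 * b ^+ 5 *: G).
split; first by rewrite intr_eq0 mulf_neq0.
  rewrite map_polyZ scalerA; congr (_ *: _).
  by field.
rewrite map_polyZ scalerA; congr (_ *: _).
by field.
Qed.

(** * Homogenized polynomials *)

(** The degree [k] may exceed that of [p]: this allows [f] and [g] to be homogenized in the weights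
    [4 * n] and [6 * n]. *)
Definition homog (p : {poly int}) (k : nat) (a b : int) : int :=
  \sum_(i < k.+1) p`_i * a ^+ i * b ^+ (k - i).

Lemma homogE (p : {poly int}) k (a b : int) : b != 0 -> (size p <= k.+1)%N ->
  (homog p k a b)%:~R = b%:~R ^+ k * (ratpoly p).[a%:~R / b%:~R] :> rat.
Proof.
move=> b0 sp; have bQ : b%:~R != 0 :> rat by rewrite intr_eq0.
rewrite (@horner_coef_wide _ k.+1) ?size_rat_int_poly //.
rewrite /homog rmorph_sum mulr_sumr; apply: eq_bigr => i _.
rewrite coef_map /= !rmorphM !rmorphXn /= expr_div_n.
have -> : b%:~R ^+ k = b%:~R ^+ (k - i) * b%:~R ^+ i :> rat.
  by rewrite -exprD subnK // -ltnS.
field; exact: expf_neq0.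
Qed.

Lemma homog_lead (p : {poly int}) k (a b : int) :
  exists z : int, homog p k a b = p`_k * a ^+ k + b * z.
Proof.
exists (\sum_(i < k) p`_i * a ^+ i * b ^+ (k - i.+1)).
rewrite /homog big_ord_recr /= subnn expr0 mulr1 addrC; congr (_ + _).
rewrite mulr_sumr; apply: eq_bigr => i _.
by rewrite -(subnSK (ltn_ord i)) exprS; ring.
Qed.

(** * Size of polynomial values *)

Lemma horner_norm_le (p : {poly rat}) k : (size p <= k.+1)%N ->
  exists2 M : rat, 0 < M &
    forall t : rat, `|p.[t]| <= M * Num.max 1 `|t| ^+ k.
Proof.
move=> sp; exists (1 + \sum_(i < k.+1) `|p`_i|).
  by rewrite ltr_pwDl // sumr_ge0.
move=> t; rewrite (horner_coef_wide _ sp).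
apply: (le_trans (ler_norm_sum _ _ _)).
have m1 : 1 <= Num.max 1 `|t| by rewrite le_max lexx.
apply: (@le_trans _ _ ((\sum_(i < k.+1) `|p`_i|) * Num.max 1 `|t| ^+ k)).
  rewrite mulr_suml; apply: ler_sum => i _.
  rewrite normrM normrX ler_wpM2l //.
  apply: (@le_trans _ _ (Num.max 1 `|t| ^+ i)).
    by rewrite lerXn2r // ?nnegrE ?le_max ?normr_ge0 ?ler01 ?lexx ?orbT.
  by rewrite ler_weXn2l // -ltnS.
by rewrite ler_wpM2r ?lerDr // exprn_ge0 // (le_trans ler01).
Qed.

Lemma horner_norm_ge (p : {poly rat}) k : size p = k.+1 ->
  exists c T : rat, [/\ 0 < c, 1 <= T &
    forall t, T <= `|t| -> c * `|t| ^+ k <= `|p.[t]|].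
Proof.
move=> sp; have L0 : 0 < `|p`_k|.
  by rewrite normr_gt0 -[k]/k.+1.-1 -sp -lead_coefE lead_coef_eq0 -size_poly_eq0 sp.
pose S : rat := \sum_(i < k) `|p`_i|.
have S0 : 0 <= S by apply: sumr_ge0.
(* The threshold makes the lower terms add up to at most half of the leading term. *)
exists (`|p`_k| / 2), (1 + 2 * S / `|p`_k|); split.
- by rewrite divr_gt0.
- by rewrite lerDl divr_ge0 // mulr_ge0.
move=> t ht.
have t1 : 1 <= `|t|.
  by apply: le_trans ht; rewrite lerDl divr_ge0 // mulr_ge0.
have t0 : 0 < `|t| by apply: lt_le_trans t1.
(* The extra factor [|t|] avoids the exponent [k - 1], which would be truncated at [k = 0]. *)
have low : `|\sum_(i < k) p`_i * t ^+ i| * `|t| <= S * `|t| ^+ k.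
  apply: (@le_trans _ _ ((\sum_(i < k) `|p`_i * t ^+ i|) * `|t|)).
    by rewrite ler_wpM2r // ler_norm_sum.
  rewrite !mulr_suml; apply: ler_sum => i _.
  by rewrite normrM normrX -mulrA -exprSr ler_wpM2l // ler_weXn2l.
have St : 2 * S <= `|p`_k| * `|t|.
  have : 2 * S / `|p`_k| <= `|t| by apply: le_trans ht; rewrite lerDr.
  by rewrite ler_pdivrMr // [leRHS]mulrC.
have low2 : `|\sum_(i < k) p`_i * t ^+ i| <= `|p`_k| / 2 * `|t| ^+ k.
  rewrite -(ler_pM2r t0); apply: (le_trans low).
  rewrite [leRHS](_ : _ = (`|p`_k| * `|t| / 2) * `|t| ^+ k); last by ring.
  by rewrite ler_wpM2r ?exprn_ge0 //; lra.
rewrite horner_coef sp big_ord_recr /= addrC.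
apply: le_trans (lerB_normD _ _); rewrite normrM normrX.
move: low2; lra.
Qed.

(** For large [|t|] the polynomial that attains the maximal degree ratio grows fast enough alone.
    For bounded [|t|] a Bezout identity prevents [f(t)] and [g(t)] from being small together. *)
Lemma coprime_horner_growth (f g : {poly rat}) (n m : nat) :
  coprimep f g -> (0 < m)%N ->
  ((size f).-1 * m = 4 * n)%N \/ ((size g).-1 * m = 6 * n)%N ->
  f != 0 -> g != 0 ->
  exists2 c : rat, 0 < c & forall t : rat,
    c * Num.max 1 `|t| ^+ (12 * n) <= `|f.[t]| ^+ (3 * m) + `|g.[t]| ^+ (2 * m).
Proof.
move=> cfg m0 hd f0 g0.
have far : exists c T : rat, [/\ 0 < c, 1 <= T & forall t : rat, T <= `|t| ->
    c * `|t| ^+ (12 * n) <= `|f.[t]| ^+ (3 * m) + `|g.[t]| ^+ (2 * m)].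
  case: hd => hd.
    have [|c [T [c0 T1 h]]] := @horner_norm_ge f (size f).-1.
      by rewrite prednK // size_poly_gt0.
    exists (c ^+ (3 * m)), T; split=> //; first exact: exprn_gt0.
    move=> t /h ht; rewrite -[leLHS]addr0 lerD ?exprn_ge0 //.
    have -> : (12 * n = (size f).-1 * (3 * m))%N by lia.
    rewrite [ `|t| ^+ _]exprM -exprMn lerXn2r ?nnegrE ?mulr_ge0 ?exprn_ge0 // ltW //.
  have [|c [T [c0 T1 h]]] := @horner_norm_ge g (size g).-1.
    by rewrite prednK // size_poly_gt0.
  exists (c ^+ (2 * m)), T; split=> //; first exact: exprn_gt0.
  move=> t /h ht; rewrite -[leLHS]add0r lerD ?exprn_ge0 //.
  have -> : (12 * n = (size g).-1 * (2 * m))%N by lia.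
  rewrite [ `|t| ^+ _]exprM -exprMn lerXn2r ?nnegrE ?mulr_ge0 ?exprn_ge0 // ltW //.
have [c [T [c0 T1 hfar]]] := far.
have T0 : 0 < T by apply: lt_le_trans T1.
have [[u v] /= uv] := Bezout_eq1_coprimepP f g cfg.
have [Mu Mu0 hu] := @horner_norm_le u (size u) (leqnSn _).
have [Mv Mv0 hv] := @horner_norm_le v (size v) (leqnSn _).
pose M : rat := 1 + Mu * T ^+ size u + Mv * T ^+ size v.
have Mu1 : 0 < Mu * T ^+ size u by rewrite mulr_gt0 // exprn_gt0.
have Mv1 : 0 < Mv * T ^+ size v by rewrite mulr_gt0 // exprn_gt0.
have M1 : 1 < M by rewrite /M; lra.
(* If [|f(t)| < d], then [M |f(t)| <= 1 / 2], so the Bezout identity leaves [M |g(t)| >= 1 / 2],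
   that is [|g(t)| >= d]. *)
pose d : rat := (2 * M)^-1.
have d0 : 0 < d by rewrite invr_gt0; lra.
have d1 : d <= 1 by rewrite invf_le1; lra.
have M_neq0 : M != 0 by rewrite gt_eqF // (lt_trans ltr01).
have Md : M * d = 1 / 2 by rewrite /d; field.
have near (t : rat) : `|t| <= T -> d ^+ (3 * m) <= `|f.[t]| ^+ (3 * m) + `|g.[t]| ^+ (2 * m).
  move=> tT.
  have mT : Num.max 1 `|t| <= T by rewrite ge_max T1.
  have m1 : 0 <= Num.max 1 `|t| by rewrite le_max ler01.
  have ut : `|u.[t]| <= M.
    apply: (le_trans (hu t)); apply: (@le_trans _ _ (Mu * T ^+ size u)).
      by rewrite ler_wpM2l ?(ltW Mu0) // lerXn2r // nnegrE // ltW.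
    rewrite /M; lra.
  have vt : `|v.[t]| <= M.
    apply: (le_trans (hv t)); apply: (@le_trans _ _ (Mv * T ^+ size v)).
      by rewrite ler_wpM2l ?(ltW Mv0) // lerXn2r // nnegrE // ltW.
    rewrite /M; lra.
  have e1 : u.[t] * f.[t] + v.[t] * g.[t] = 1.
    by rewrite -!hornerM -hornerD uv hornerC.
  have e2 : 1 <= M * `|f.[t]| + M * `|g.[t]|.
    have := ler_normD (u.[t] * f.[t]) (v.[t] * g.[t]).
    rewrite e1 normr1 !normrM => /le_trans; apply.
    by rewrite lerD // ler_wpM2r.
  have [df|fd] := leP d `|f.[t]|.
    rewrite -[leLHS]addr0 lerD ?exprn_ge0 // lerXn2r ?nnegrE // ltW //.
  have dg : d <= `|g.[t]|.
    have Mf : M * `|f.[t]| <= 1 / 2.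
      by rewrite -Md ler_wpM2l ?(ltW fd) //; lra.
    rewrite -(ler_pM2l (_ : 0 < M)); last by lra.
    rewrite Md; lra.
  rewrite -[leLHS]add0r lerD ?exprn_ge0 //.
  (* As [d <= 1], the power [d ^ (3 * m)] is the smaller one and serves both cases. *)
  apply: (@le_trans _ _ (d ^+ (2 * m))).
    by rewrite ler_wiXn2l // ?ltW // leq_mul2r orbT.
  by rewrite lerXn2r ?nnegrE // ltW.
exists (Num.min c (d ^+ (3 * m) / T ^+ (12 * n))).
  by rewrite lt_min c0 divr_gt0 // exprn_gt0.
move=> t.
have [tT|Tt] := leP `|t| T.
  apply: le_trans (near t tT).
  apply: (@le_trans _ _ (d ^+ (3 * m) / T ^+ (12 * n) * T ^+ (12 * n))).
    have m1 : 0 <= Num.max 1 `|t| by rewrite le_max ler01.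
    apply: ler_pM; rewrite ?exprn_ge0 ?ge_min ?lexx ?orbT //.
      by rewrite le_min (ltW c0) divr_ge0 // exprn_ge0 // ltW.
    by rewrite lerXn2r ?nnegrE ?(ltW T0) // ge_max T1.
  by rewrite divfK // expf_neq0 // gt_eqF.
have -> : Num.max 1 `|t| = `|t| by apply/max_idPr; apply: ltW; apply: le_lt_trans Tt.
apply: le_trans (hfar t (ltW Tt)).
by rewrite ler_wpM2r ?exprn_ge0 // ge_min lexx.
Qed.

(** * Common factors of homogenized values *)

Lemma Gauss_dvdz_gcd (y c a b : int) : coprimez a b ->
  (y %| c * a)%Z -> (y %| c * b)%Z -> (y %| c)%Z.
Proof.
move=> /coprimezP [[u v] /= uv] ya yb.
have -> : c = (c * a) * u + (c * b) * v.
  by rewrite -{1}[c]mulr1 -uv; ring.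
by rewrite rpredD // dvdz_mulr.
Qed.

Lemma integral_Bezout (F G : {poly int}) :
  coprimep (ratpoly F) (ratpoly G) ->
  exists (P Q : {poly int}) (d : int), d != 0 /\ P * F + Q * G = d%:P.
Proof.
move=> /Bezout_eq1_coprimepP [[u v] /= uv].
have [P [a a0 eu]] := rat_poly_scale u; have [Q [b b0 ev]] := rat_poly_scale v.
have aQ : a%:~R != 0 :> rat by rewrite intr_eq0.
have bQ : b%:~R != 0 :> rat by rewrite intr_eq0.
exists (b *: P), (a *: Q), (a * b); split; first by rewrite mulf_neq0.
have inj : injective ratpoly by apply: map_inj_poly => //; exact: intr_inj.
apply: inj; rewrite rmorphD /= rmorphM rmorphM /= !map_polyZ /= map_polyC /= rmorphM /=.
rewrite -[RHS]mulr1 -uv eu ev mulrDr -!mul_polyC !polyCM.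
have ea : a%:~R%:P * (a%:~R^-1)%:P = 1 :> {poly rat} by rewrite -polyCM mulfV.
have eb : b%:~R%:P * (b%:~R^-1)%:P = 1 :> {poly rat} by rewrite -polyCM mulfV.
ring: ea eb.
Qed.

(* A Bezout identity bounds the common factor up to powers of [b], and a
   non-zero leading coefficient bounds the common factor with powers of [b]. *)
Lemma dvd_homog_bounded (F G : {poly int}) (k l : nat) :
  coprimep (ratpoly F) (ratpoly G) ->
  (size F <= k.+1)%N -> (size G <= l.+1)%N -> F`_k != 0 \/ G`_l != 0 ->
  exists2 C : int, C != 0 & forall a b y : int, b != 0 -> coprimez a b ->
    (y %| homog F k a b)%Z -> (y %| homog G l a b)%Z -> (y %| C)%Z.
Proof.
move=> cFG sF sG lead.
have [P [Q [d [d0 PQ]]]] := integral_Bezout _ _ cFG.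
pose N := (size P + size Q + k + l)%N.
(* Homogenizing [P * F + Q * G = d] at [(a, b)] multiplies [d] by [b ^ N], where [N] adds up the
   four degrees used. *)
have bez (a b y : int) : b != 0 -> (y %| homog F k a b)%Z -> (y %| homog G l a b)%Z ->
    (y %| d * b ^+ N)%Z.
  move=> b0 yF yG; have bQ : b%:~R != 0 :> rat by rewrite intr_eq0.
  have -> : d * b ^+ N = b ^+ (size Q + l) * homog P (size P) a b * homog F k a b +
      b ^+ (size P + k) * homog Q (size Q) a b * homog G l a b.
    apply: (@intr_inj rat).
    rewrite rmorphD !rmorphM !rmorphXn /= !homogE //; try exact: leqnSn.
    have := congr1 (fun p => (ratpoly p).[a%:~R / b%:~R]) PQ.
    rewrite rmorphD !rmorphM /= map_polyC /= hornerC hornerD !hornerM => <-.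
    by rewrite /N !exprD; ring.
  by rewrite rpredD // dvdz_mull.
(* Modulo [y] the top term is a multiple of [b], so its [N]-th power times [d] vanishes with
   [d * b ^ N]. As [a] and [b] are coprime, the powers of [a] and [b] can then be dropped. *)
have lem (p : {poly int}) (j : nat) (a b y : int) : b != 0 -> coprimez a b ->
    (y %| homog p j a b)%Z -> (y %| d * b ^+ N)%Z -> (y %| d * p`_j ^+ N)%Z.
  move=> b0 ab yp yd; apply: (@Gauss_dvdz_gcd _ _ (a ^+ (j * N)) (b ^+ N)).
  - exact/coprimezXl/coprimezXr.
  - have [z hz] := homog_lead p j a b; rewrite hz in yp.
    have e : p`_j * a ^+ j = - (b * z) + (p`_j * a ^+ j + b * z) by ring.
    rewrite exprM -mulrA -exprMn e.
    have [q hq] := dvdzP yp; rewrite hq.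
    have : forall M, exists w, (- (b * z) + q * y) ^+ M = (- (b * z)) ^+ M + w * y.
      elim=> [|M [w IH]]; first by exists 0; rewrite mul0r addr0 !expr0.
      exists (- (b * z) * w + q * ((- (b * z)) ^+ M + w * y)).
      by rewrite !exprS IH; ring.
    move=> /(_ N) [w ->]; rewrite mulrDr rpredD //; last by rewrite mulrA dvdz_mull.
    by rewrite -mulrN exprMn mulrA dvdz_mulr.
  - by rewrite mulrAC dvdz_mulr.
case: lead => lead.
  exists (d * F`_k ^+ N); first by rewrite mulf_neq0 // expf_neq0.
  by move=> a b y b0 ab yF yG; apply: (lem F k a b) => //; exact: bez yF yG.
exists (d * G`_l ^+ N); first by rewrite mulf_neq0 // expf_neq0.
by move=> a b y b0 ab yF yG; apply: (lem G l a b) => //; exact: bez yF yG.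
Qed.

(** Modulo [b] the form reduces to its term in [a ^ k], and [a] is prime to [b]. Each further factor
    [b] of [x] is thus gained at the cost of one factor of the coefficient of degree [k]. *)
Lemma dvd_exp_homog (p : {poly int}) (k : nat) (a b x : int) :
  coprimez a b -> (b ^+ k %| x * homog p k a b)%Z -> (b ^+ k %| x * p`_k ^+ k)%Z.
Proof.
move=> ab; have [z ->] := homog_lead p k a b => hb.
suff H j : (j <= k)%N -> (b ^+ j %| x * p`_k ^+ j)%Z by exact: H.
elim: j => [|j IH] jk; first by rewrite expr0 dvd1z.
have := IH (ltnW jk) => hj.
have bx : (b ^+ j.+1 %| x * (p`_k * a ^+ k + b * z))%Z.
  by apply: dvdz_trans hb; rewrite dvdz_exp2l.
have : (b ^+ j.+1 %| x * p`_k ^+ j.+1 * a ^+ k)%Z.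
  have -> : x * p`_k ^+ j.+1 * a ^+ k =
    x * (p`_k * a ^+ k + b * z) * p`_k ^+ j - b * (x * p`_k ^+ j) * z.
    by rewrite exprS; ring.
  by rewrite rpredB // dvdz_mulr // exprS dvdz_mul.
rewrite Gauss_dvdzl //; apply/coprimezXl; rewrite coprimez_sym; exact: coprimezXl.
Qed.

(** * Denominators of the parameters *)

Lemma coprimez_numq_denq (v : rat) : coprimez (numq v) (denq v).
Proof. by rewrite coprimezE coprime_num_den. Qed.

Lemma rat_coprime_fraction (t : rat) :
  exists a b : int, [/\ b != 0, coprimez a b & t = a%:~R / b%:~R].
Proof.
exists (numq t), (denq t); rewrite denq_neq0 divq_num_den; split=> //.
exact: coprimez_numq_denq.
Qed.

Lemma clear_denq (v : rat) (e : nat) (h A : int) :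
  A%:~R = v ^+ e * h%:~R -> A * denq v ^+ e = numq v ^+ e * h.
Proof.
move=> hA; apply: (@intr_inj rat); rewrite !rmorphM !rmorphXn /= hA.
rewrite -{1}[v]divq_num_den expr_div_n.
have d0 : (denq v)%:~R ^+ e != 0 :> rat by rewrite expf_neq0 // intr_eq0 denq_neq0.
by field.
Qed.

Lemma denq_dvd (v : rat) (e : nat) (h A : int) : (0 < e)%N ->
  A%:~R = v ^+ e * h%:~R -> (denq v %| h)%Z.
Proof.
move=> e0 /clear_denq hA.
have : (denq v ^+ e %| numq v ^+ e * h)%Z by rewrite -hA dvdz_mull.
rewrite Gauss_dvdzr.
  by move=> h'; apply: dvdz_trans h'; rewrite dvdz_exp.
by apply/coprimezXl/coprimezXr; rewrite coprimez_sym coprimez_numq_denq.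
Qed.

(** Integrality of [A] makes [b ^ k] divide [numq u ^ e] times the [k]-th power of the top
    coefficient. Raising to the power [m] turns [b ^ k] into [b ^ e], after which [e]-th roots can
    be taken. The result is weakened to a full [m]-th power, the shape wanted for a denominator of
    [t]. *)
Lemma dvd_param (p : {poly int}) (k e m : nat) (a b A : int) (u : rat) :
  (0 < e)%N -> (0 < m)%N -> (k * m = e)%N -> (size p <= k.+1)%N -> b != 0 ->
  coprimez a b -> A%:~R = u ^+ e * (ratpoly p).[a%:~R / b%:~R] ->
  (b %| (numq u * p`_k) ^+ m)%Z.
Proof.
move=> e0 m0 kme sp b0 ab hA.
have bk : b%:~R ^+ k != 0 :> rat by rewrite expf_neq0 // intr_eq0.
have /clear_denq h : (A * b ^+ k)%:~R = u ^+ e * (homog p k a b)%:~R.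
  by rewrite homogE // rmorphM rmorphXn /= hA; ring.
have : (b ^+ k %| numq u ^+ e * homog p k a b)%Z.
  by rewrite -h mulrAC dvdz_mull.
move=> /(dvd_exp_homog _ _ _ _ _ ab).
rewrite -(dvdz_pexp2r m) // exprMn -!exprM kme [(e * m)%N]mulnC exprM -exprMn.
rewrite dvdz_pexp2r // => /dvdz_trans; apply.
by rewrite exprMn dvdz_mul // dvdz_exp.
Qed.

Lemma normr_intr_ge1 (q : int) : q != 0 -> 1 <= `|q%:~R : rat|.
Proof. by move=> q0; rewrite -intr_norm -[1]/(1%:~R) ler_int; lia. Qed.

Lemma dvdz_norm_le (y C : int) : C != 0 -> (y %| C)%Z ->
  `|y%:~R : rat| <= `|C%:~R|.
Proof.
move=> C0 yC; rewrite -!intr_norm ler_int -!abszE lez_nat.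
by apply: dvdn_leq; rewrite ?absz_gt0 // -dvdzE.
Qed.

(** Here [u] is the scaling factor from the curve at [t] to an integral equation. The fraction need
    not be reduced, since only the sizes of [a] and [w] are counted later. *)
Definition small_denominator (f g : {poly rat}) (n m : nat) : Prop :=
  exists2 C : rat, 0 < C & forall (t u : rat) (A B : int), u != 0 ->
    A%:~R = u ^+ 4 * f.[t] -> B%:~R = u ^+ 6 * g.[t] ->
    exists a w : int,
      [/\ w != 0, t = a%:~R / w%:~R ^+ m & `|w%:~R| ^+ n <= C * `|u|].

(** For [v = u / b ^ n], both [v ^ 4] and [v ^ 6] times the forms of weights [4 * n] and [6 * n] are
    integers. So the denominator of [v] divides both forms and is bounded, which bounds [|v|] from
    below. *)
Lemma small_denominator_m1 (F G : {poly int}) (n : nat) :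
  coprimep (ratpoly F) (ratpoly G) ->
  (size F <= (4 * n).+1)%N -> (size G <= (6 * n).+1)%N ->
  F`_(4 * n) != 0 \/ G`_(6 * n) != 0 ->
  small_denominator (ratpoly F) (ratpoly G) n 1.
Proof.
move=> cFG sF sG lead; have [C C0 hC] := dvd_homog_bounded _ _ _ _ cFG sF sG lead.
exists `|C%:~R|; first by rewrite normr_gt0 intr_eq0.
move=> t u A B u0 hA hB; have [a [b [b0 ab et]]] := rat_coprime_fraction t.
exists a, b; split=> //.
have bn : b%:~R ^+ n != 0 :> rat by rewrite expf_neq0 // intr_eq0.
pose v := u / b%:~R ^+ n.
have yF : (denq v %| homog F (4 * n) a b)%Z.
  apply: (denq_dvd v 4 _ A) => //; rewrite hA homogE // -et /v mulnC exprM.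
  by field.
have yG : (denq v %| homog G (6 * n) a b)%Z.
  apply: (denq_dvd v 6 _ B) => //; rewrite hB homogE // -et /v mulnC exprM.
  by field.
have v0 : v != 0 by rewrite mulf_neq0 // invr_eq0.
have yC := dvdz_norm_le _ _ C0 (hC _ _ _ b0 ab yF yG).
have -> : `|u| = `|v| * `|b%:~R| ^+ n.
  by rewrite -normrX -normrM /v divfK.
rewrite mulrA ler_peMl ?exprn_ge0 //.
rewrite -{1}[v]divq_num_den normf_div.
have y0 : 0 < `|(denq v)%:~R : rat| by rewrite normr_gt0 intr_eq0 denq_neq0.
rewrite mulrA ler_pdivlMr // mul1r (le_trans yC) // ler_peMr //.
by rewrite normr_intr_ge1 // numq_eq0.
Qed.

(** Take [w = numq u * L], with [L] the top coefficient of a polynomial attaining the maximum: [b]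
    divides [w ^ m], so [t] can be written over [w ^ m]. The denominator of [u] divides both forms
    and is bounded, hence [|w|] is [O(|u|)]. *)
Lemma small_denominator_n1 (F G : {poly int}) (k l m : nat) :
  coprimep (ratpoly F) (ratpoly G) -> (0 < m)%N ->
  (size F <= k.+1)%N -> (size G <= l.+1)%N -> F`_k != 0 -> G`_l != 0 ->
  (k * m = 4)%N \/ (l * m = 6)%N ->
  small_denominator (ratpoly F) (ratpoly G) 1 m.
Proof.
move=> cFG m0 sF sG F0 G0 hd.
have [C C0 hC] := dvd_homog_bounded _ _ _ _ cFG sF sG (or_introl F0).
pose L := if (k * m == 4)%N then F`_k else G`_l.
have L0 : L != 0 by rewrite /L; case: ifP.
exists (`|C%:~R| * `|L%:~R|); first by rewrite mulr_gt0 // normr_gt0 intr_eq0.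
move=> t u A B u0 hA hB; have [a [b [b0 ab et]]] := rat_coprime_fraction t.
have hb : (b %| (numq u * L) ^+ m)%Z.
  rewrite /L; case: eqP => [hk|hk].
    by apply: (@dvd_param F k 4 m a b A u) => //; rewrite -et.
  have hl : (l * m = 6)%N by case: hd.
  by apply: (@dvd_param G l 6 m a b B u) => //; rewrite -et.
have [q hq] := dvdzP hb.
have w0 : numq u * L != 0 by rewrite mulf_neq0 // numq_eq0.
exists (a * q), (numq u * L); split=> //.
  have wm : (numq u * L) ^+ m != 0 by rewrite expf_neq0.
  rewrite -rmorphXn /= hq et.
  have q0 : q != 0 by apply: contraNneq wm => q0; rewrite hq q0 mul0r.
  have qQ : q%:~R != 0 :> rat by rewrite intr_eq0.
  have bQ : b%:~R != 0 :> rat by rewrite intr_eq0.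
  by rewrite !rmorphM /=; field; rewrite qQ bQ.
have yF : (denq u %| homog F k a b)%Z.
  apply: (denq_dvd u 4 _ (A * b ^+ k)) => //.
  by rewrite homogE // -et rmorphM rmorphXn /= hA; ring.
have yG : (denq u %| homog G l a b)%Z.
  apply: (denq_dvd u 6 _ (B * b ^+ l)) => //.
  by rewrite homogE // -et rmorphM rmorphXn /= hB; ring.
have yC := dvdz_norm_le _ _ C0 (hC _ _ _ b0 ab yF yG).
have dQ : (denq u)%:~R != 0 :> rat by rewrite intr_eq0 denq_neq0.
have eu : (numq u)%:~R = u * (denq u)%:~R by rewrite -{2}[u]divq_num_den divfK.
rewrite expr1 rmorphM normrM /= eu normrM.
rewrite [leRHS](_ : _ = `|u| * `|C%:~R| * `|L%:~R|); last by ring.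
by rewrite ler_wpM2r // ler_wpM2l.
Qed.

(** * The box containing the parameters of bounded height *)

(** Let [v] be the scaling factor to the minimal model. Height at most [H] bounds
    [|v| ^ 12m (|f(t)| ^ 3m + |g(t)| ^ 2m)] by [2 H ^ m]. With the growth estimate and
    [|w| ^ n <= C |v|] this bounds [|w| ^ 12nm max(1, |t|) ^ 12n] by [K H ^ m], which contains both
    conclusions. *)
Lemma good_param_box (f g : {poly rat}) (n m : nat) (c : rat) :
  (0 < m)%N -> small_denominator f g n m -> 0 < c ->
  (forall t : rat, c * Num.max 1 `|t| ^+ (12 * n) <=
     `|f.[t]| ^+ (3 * m) + `|g.[t]| ^+ (2 * m)) ->
  exists K : nat, forall (H : nat) (t : rat), good_param f g H t ->
    exists a w : int, [/\ t = a%:~R / w%:~R ^+ m,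
      (`|w| ^ (12 * n) <= K * H)%N & (`|a| ^ (12 * n) <= K * H ^ m)%N].
Proof.
move=> m0 [C C0 hC] c0 growth.
pose D := C ^+ (12 * m) * (2 / c).
have D0 : 0 <= D by rewrite mulr_ge0 ?exprn_ge0 ?divr_ge0 // ltW.
pose K := (Num.truncn D).+1.
have DK : D <= K%:R by apply/ltW; rewrite truncnS_gt.
exists K => H t [et [h [A [B [[_ /isomorphic_shortP [u u0 [ef eg]]] eh]]] hH]].
have U0 : u^-1 != 0 by rewrite invr_eq0.
have hA : A%:~R = u^-1 ^+ 4 * f.[t] by rewrite ef; field.
have hB : B%:~R = u^-1 ^+ 6 * g.[t] by rewrite eg; field.
have [a [w [w0 tE hw]]] := hC t u^-1 A B U0 hA hB.
have wQ : w%:~R != 0 :> rat by rewrite intr_eq0.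
have AH : `|A%:~R| ^+ 3 <= H%:R :> rat.
  rewrite -intr_norm -rmorphXn /= pmulrn ler_int; apply: le_trans hH.
  by rewrite eh le_max lexx.
have BH : `|B%:~R| ^+ 2 <= H%:R :> rat.
  rewrite -intr_norm -rmorphXn /= pmulrn ler_int; apply: le_trans hH.
  by rewrite eh le_max lexx orbT.
pose P := `|u^-1| ^+ (12 * m).
pose M := Num.max 1 `|t|.
have P0 : 0 <= P by apply: exprn_ge0.
have M1 : 1 <= M by rewrite le_max lexx.
have tM : `|t| <= M by rewrite le_max lexx orbT.
have fP : P * `|f.[t]| ^+ (3 * m) <= H%:R ^+ m.
  have -> : P * `|f.[t]| ^+ (3 * m) = (`|A%:~R| ^+ 3) ^+ m.
    have e : (12 * m = 4 * (3 * m))%N by rewrite mulnA.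
    by rewrite /P e [ `|u^-1| ^+ _]exprM -exprMn -normrX -normrM -hA exprM.
  by rewrite lerXn2r ?nnegrE ?exprn_ge0.
have gP : P * `|g.[t]| ^+ (2 * m) <= H%:R ^+ m.
  have -> : P * `|g.[t]| ^+ (2 * m) = (`|B%:~R| ^+ 2) ^+ m.
    have e : (12 * m = 6 * (2 * m))%N by rewrite mulnA.
    by rewrite /P e [ `|u^-1| ^+ _]exprM -exprMn -normrX -normrM -hB exprM.
  by rewrite lerXn2r ?nnegrE ?exprn_ge0.
have PM : C ^+ (12 * m) * P * M ^+ (12 * n) <= K%:R * H%:R ^+ m.
  have Hm : 0 <= H%:R ^+ m :> rat by rewrite exprn_ge0.
  apply: (@le_trans _ _ (D * H%:R ^+ m)); last by rewrite ler_wpM2r.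
  rewrite /D -!mulrA ler_wpM2l ?exprn_ge0 ?(ltW C0) //.
  rewrite -(ler_pM2l c0) [leRHS](_ : _ = 2 * H%:R ^+ m); last first.
    by field; rewrite gt_eqF.
  apply: (@le_trans _ _ (P * (`|f.[t]| ^+ (3 * m) + `|g.[t]| ^+ (2 * m)))).
    by rewrite mulrCA; apply: ler_wpM2l P0 _ _ (growth t).
  by rewrite mulrDr mulr_natl mulr2n lerD.
have wP : `|w%:~R| ^+ (12 * n * m) <= C ^+ (12 * m) * P.
  have -> : (12 * n * m = n * (12 * m))%N by rewrite -mulnA mulnCA.
  rewrite exprM /P -exprMn lerXn2r ?nnegrE ?exprn_ge0 //.
  by rewrite mulr_ge0 // ltW.
have CP : 0 <= C ^+ (12 * m) * P by rewrite mulr_ge0 // exprn_ge0 // ltW.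
exists a, w; split=> //.
  have H1 : (`|w| ^ (12 * n)) %:R <= (K * H)%:R :> rat.
    rewrite -(ler_pXn2r m0) ?nnegrE // natrX natr_absz intr_norm -exprM.
    apply: (le_trans wP); rewrite natrM exprMn.
    apply: (@le_trans _ _ (C ^+ (12 * m) * P * M ^+ (12 * n))).
      by rewrite ler_peMr // exprn_ege1.
    (* Weakening [K] to [K ^ m] makes both sides [m]-th powers. *)
    apply: (le_trans PM); rewrite ler_wpM2r ?exprn_ge0 //.
    by rewrite ler_eXnr // ler1n.
  by rewrite ler_nat in H1.
have H1 : (`|a| ^ (12 * n))%:R <= (K * H ^ m)%:R :> rat.
  rewrite natrX natr_absz intr_norm.
  have -> : a%:~R = t * w%:~R ^+ m by rewrite tE divfK // expf_neq0.
  rewrite normrM normrX exprMn -exprM [(m * _)%N]mulnC natrM natrX.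
  apply: le_trans PM; rewrite mulrC ler_pM ?exprn_ge0 //.
  by rewrite lerXn2r // nnegrE // (le_trans ler01).
by rewrite ler_nat in H1.
Qed.

(** * Heights of the curves at given fractions *)

Lemma leq_expn2r (x y k : nat) : (x <= y)%N -> (x ^ k <= y ^ k)%N.
Proof. by case: k => // k; rewrite leq_exp2r. Qed.

Lemma homog_norm_le (p : {poly int}) (k a b T : nat) :
  (a <= T)%N -> (b <= T)%N ->
  (`|homog p k a b| <= (\sum_(i < k.+1) `|(p`_i)%R|) * T ^ k)%N.
Proof.
move=> aT bT; rewrite -lez_nat abszE /homog.
apply: (le_trans (ler_norm_sum _ _ _)).
rewrite PoszM (big_morph Posz PoszD (erefl _)) mulr_suml; apply: ler_sum => i _.
rewrite -!abszE -PoszM lez_nat !abszM -mulnA leq_mul2l !abszX !absz_nat.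
apply/orP; right; have -> : (T ^ k = T ^ i * T ^ (k - i))%N.
  by rewrite -expnD subnKC // -ltnS.
by rewrite leq_mul ?leq_expn2r.
Qed.

(** The form at [(a, w ^ m)] has size [O(Z ^ (r * m))]; the missing power of [w] is supplied as a
    factor. *)
Lemma homog_numerator (p : {poly int}) (r e m a w Z : nat) :
  (size p <= r.+1)%N -> (r * m <= e)%N -> (0 < w)%N -> (w <= Z)%N ->
  (a <= Z ^ m)%N ->
  exists2 A : int, A%:~R = w%:R ^+ e * (ratpoly p).[a%:R / w%:R ^+ m] &
    (`|A| <= (\sum_(i < r.+1) `|(p`_i)%R|) * Z ^ e)%N.
Proof.
move=> sp rme w0 wZ aZ; exists (w%:Z ^+ (e - r * m) * homog p r a (w ^ m)%N).
  rewrite rmorphM rmorphXn /= homogE //; last by rewrite -lt0n expn_gt0 w0.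
  by rewrite -!pmulrn natrX mulrA -exprM [(m * r)%N]mulnC -exprD subnK.
rewrite abszM abszX absz_nat mulnC.
apply: (leq_trans (leq_mul (homog_norm_le p r a (w ^ m) (Z ^ m) aZ (leq_expn2r _ _ _ wZ))
  (leq_expn2r _ _ (e - r * m)%N wZ))).
by rewrite -mulnA leq_mul2l -expnM [(m * r)%N]mulnC -expnD subnKC ?leqnn ?orbT.
Qed.

(** Scaling by [w ^ n] gives integral coefficients of sizes [O(Z ^ 4n)] and [O(Z ^ 6n)], and passing
    to the minimal model does not increase them. *)
Lemma good_param_fraction (F G : {poly int}) (r s n m : nat) :
  (size F <= r.+1)%N -> (size G <= s.+1)%N ->
  (r * m <= 4 * n)%N -> (s * m <= 6 * n)%N ->
  exists S : nat, forall Z a w : nat, (0 < w)%N -> (w <= Z)%N -> (a <= Z ^ m)%N ->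
    let t := a%:R / w%:R ^+ m in
    elliptic (family (ratpoly F) (ratpoly G) t) ->
    good_param (ratpoly F) (ratpoly G) (S * Z ^ (12 * n)) t.
Proof.
move=> sF sG hr hs.
pose SF := (\sum_(i < r.+1) `|(F`_i)%R|)%N; pose SG := (\sum_(i < s.+1) `|(G`_i)%R|)%N.
exists (SF ^ 3 + SG ^ 2)%N => Z a w w0 wZ aZ t et; split=> //.
have [A hA lA] := homog_numerator F r (4 * n) m a w Z sF hr w0 wZ aZ.
have [B hB lB] := homog_numerator G s (6 * n) m a w Z sG hs w0 wZ aZ.
have wQ : w%:R ^+ n != 0 :> rat by rewrite expf_neq0 // pnatr_eq0 -lt0n.
have iso : isomorphic (short_weierstrass A%:~R B%:~R)
    (family (ratpoly F) (ratpoly G) t).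
  by apply/isomorphic_shortP; exists (w%:R ^+ n); rewrite // -!exprM ![(n * _)%N]mulnC.
have AB0 : (A != 0) || (B != 0).
  rewrite -negb_and; apply/negP => /andP[/eqP A0 /eqP B0].
  have := elliptic_isomorphic_short _ _ _ _ (isomorphic_sym _ _ iso) et.
  by move=> /elliptic_shortE /eqP; apply; rewrite A0 B0; ring.
have [A' [B' [hm lA' lB']]] := minimal_model A B AB0.
exists (Num.max (`|A'| ^+ 3) (`|B'| ^+ 2)).
  by apply: has_height_isomorphic iso _; exists A', B'.
have {}lA' : (`|A'| <= `|A|)%N by move: lA'; rewrite -!abszE lez_nat.
have {}lB' : (`|B'| <= `|B|)%N by move: lB'; rewrite -!abszE lez_nat.
have hA3 : (`|A'| ^ 3 <= SF ^ 3 * Z ^ (12 * n))%N.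
  apply: (leq_trans (leq_expn2r _ _ 3 (leq_trans lA' lA))).
  by rewrite expnMn -expnM mulnAC.
have hB2 : (`|B'| ^ 2 <= SG ^ 2 * Z ^ (12 * n))%N.
  apply: (leq_trans (leq_expn2r _ _ 2 (leq_trans lB' lB))).
  by rewrite expnMn -expnM mulnAC.
have PoszX (x k : nat) : (x ^ k)%N%:Z = x%:Z ^+ k by rewrite -[LHS]natz natrX natz.
rewrite ge_max -!abszE -!PoszX !lez_nat mulnDl.
by rewrite (leq_trans hA3) ?leq_addr // (leq_trans hB2) ?leq_addl.
Qed.

(** * Fibres of the map from parameters to classes *)

(** Otherwise, if neither scalar is zero, [f ^ 3] and [g ^ 2] are proportional, so each of [f] and
    [g] divides a power of the other. Being coprime, both would be constant. *)
Lemma comb_cube_square_neq0 (f g : {poly rat}) (x y : rat) :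
  f != 0 -> g != 0 -> coprimep f g -> (1 < size f)%N \/ (1 < size g)%N ->
  x != 0 \/ y != 0 -> x *: f ^+ 3 + y *: g ^+ 2 != 0.
Proof.
move=> f0 g0 cfg sfg xy; apply/eqP => e.
have f3 : f ^+ 3 != 0 by rewrite expf_neq0.
have g2 : g ^+ 2 != 0 by rewrite expf_neq0.
have [x0|x0] := eqVneq x 0.
  case: xy => [|y0]; first by rewrite x0 eqxx.
  by move/eqP: e; rewrite x0 scale0r add0r scaler_eq0 (negbTE y0) (negbTE g2).
have [y0|y0] := eqVneq y 0.
  by move/eqP: e; rewrite y0 scale0r addr0 scaler_eq0 (negbTE x0) (negbTE f3).
have e1 : f ^+ 3 = (- (y / x)) *: g ^+ 2.
  apply: (scalerI x0); rewrite scalerA mulrN mulrCA mulfV // mulr1 scaleNr.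
  by apply/eqP; rewrite -addr_eq0 e.
have e2 : g ^+ 2 = (- (x / y)) *: f ^+ 3.
  apply: (scalerI y0); rewrite scalerA mulrN mulrCA mulfV // mulr1 scaleNr.
  by apply/eqP; rewrite -addr_eq0 addrC e.
case: sfg => s.
  have : coprimep f f.
    apply: (@coprimep_dvdl _ (g ^+ 2)); last exact: coprimep_expr.
    by rewrite e2 dvdpZr ?dvdp_exp // oppr_eq0 mulf_neq0 // invr_eq0.
  by rewrite coprimepp => /eqP s1; rewrite s1 in s.
have : coprimep g g.
  apply: (@coprimep_dvdl _ (f ^+ 3)); last by rewrite coprimep_expr // coprimep_sym.
  by rewrite e1 dvdpZr ?dvdp_exp // oppr_eq0 mulf_neq0 // invr_eq0.
by rewrite coprimepp => /eqP s1; rewrite s1 in s.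
Qed.

Lemma size_comb_cube_square (f g : {poly rat}) (x y : rat) :
  (size (x *: f ^+ 3 + y *: g ^+ 2)%R <= size (f ^+ 3)%R + size (g ^+ 2)%R)%N.
Proof.
apply: (leq_trans (size_polyD _ _)); rewrite geq_max.
rewrite (leq_trans (size_scale_leq _ _)) ?leq_addr //=.
by rewrite (leq_trans (size_scale_leq _ _)) ?leq_addl.
Qed.

Lemma uniq_roots_bound (p : {poly rat}) (s : seq rat) (k : nat) :
  p != 0 -> (size p <= k)%N -> uniq s -> {in s, forall t, p.[t] = 0} ->
  (size s <= k)%N.
Proof.
move=> p0 pk us hs; apply: leq_trans pk; apply: ltnW.
apply: max_poly_roots => //; apply/allP => t /hs ht; exact/rootP.
Qed.

Lemma isomorphic_fiber_bound (f g : {poly rat}) (t : rat) (s : seq rat) :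
  f != 0 -> g != 0 -> coprimep f g -> (1 < size f)%N \/ (1 < size g)%N ->
  elliptic (family f g t) -> uniq s ->
  {in s, forall t', isomorphic (family f g t) (family f g t')} ->
  (size s <= size (f ^+ 3)%R + size (g ^+ 2)%R)%N.
Proof.
move=> f0 g0 cfg sfg et us hs.
apply: (uniq_roots_bound ((- g.[t] ^+ 2) *: f ^+ 3 + f.[t] ^+ 3 *: g ^+ 2) s) => //.
(* The coefficients cannot both vanish: [f(t) = g(t) = 0] would make the curve at [t] singular. *)
- apply: comb_cube_square_neq0 => //; rewrite oppr_eq0 !expf_eq0 /=.
  have [ft|] := eqVneq f.[t] 0; last by right.
  have [gt|] := eqVneq g.[t] 0; last by left.
  by move: et => /elliptic_shortE /eqP; case; rewrite ft gt; ring.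
- exact: size_comb_cube_square.
move=> t' /hs /isomorphic_shortP [u u0 [-> ->]].
rewrite hornerD !hornerZ !horner_exp; ring.
Qed.

Lemma non_elliptic_bound (f g : {poly rat}) (s : seq rat) :
  f != 0 -> g != 0 -> coprimep f g -> (1 < size f)%N \/ (1 < size g)%N ->
  uniq s -> {in s, forall t, ~ elliptic (family f g t)} ->
  (size s <= size (f ^+ 3)%R + size (g ^+ 2)%R)%N.
Proof.
move=> f0 g0 cfg sfg us hs.
apply: (uniq_roots_bound (4 *: f ^+ 3 + 27 *: g ^+ 2) s) => //.
- by apply: comb_cube_square_neq0 => //; left.
- exact: size_comb_cube_square.
move=> t /hs nt; apply/eqP/negPn/negP => h; apply: nt; apply/elliptic_shortE.
by move: h; rewrite hornerD !hornerZ !horner_exp.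
Qed.

Lemma size_le_fibers (T S : eqType) (h : T -> S) (k : nat) (cs : seq S) (s : seq T) :
  {in s, forall x, h x \in cs} ->
  (forall c, c \in cs -> (count (fun x => h x == c) s <= k)%N) ->
  (size s <= k * size cs)%N.
Proof.
elim: cs s => [|c cs IH] s hs hk.
  by case: s hs hk => // x s hs; have := hs x; rewrite inE eqxx => /(_ isT).
rewrite -(count_predC (fun x => h x == c)) /= mulnS leq_add //.
  by apply: hk; rewrite inE eqxx.
rewrite -size_filter; apply: IH => [x|d dcs].
  rewrite mem_filter => /andP[/= xc /hs]; rewrite inE => /orP[/eqP e|//].
  by rewrite e eqxx in xc.
rewrite count_filter; apply: (leq_trans (sub_count _ _)); last first.
  by apply: (hk d); rewrite inE dcs orbT.
by move=> x /andP[].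
Qed.

(** * Density of coprime pairs *)

Lemma sum_dvdn_index (d n : nat) : (0 < d)%N ->
  (\sum_(1 <= i < n.+1) (d %| i) = n %/ d)%N.
Proof.
move=> d0; elim: n => [|n IH]; first by rewrite big_geq // div0n.
by rewrite big_nat_recr //= IH divnS // addnC.
Qed.

(** The sum telescopes by [1 / d ^ 2 <= 1 / (d - 1) - 1 / d] from [d = 3] on. The term
    [1 / 4 = 3 / 4 - 1 / 2] is kept exact: telescoping from [d = 2] would only give the bound 1 and
    no positive density. *)
Lemma sum_inv_square (n : nat) :
  \sum_(2 <= d < n.+3) (d%:R ^- 2 : rat) <= 3 / 4 - n.+2%:R^-1.
Proof.
elim: n => [|n IH]; first (rewrite big_nat1; lra).
rewrite big_nat_recr //=; have n0 : 0 <= n%:R :> rat by [].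
have -> : n.+3%:R = n%:R + 3 :> rat by rewrite -addn3 natrD.
have e2 : n.+2%:R = n%:R + 2 :> rat by rewrite -addn2 natrD.
rewrite e2 in IH.
have h : (n%:R + 3)^-2 + (n%:R + 3)^-1 <= (n%:R + 2)^-1 :> rat.
  rewrite -subr_ge0.
  have -> : (n%:R + 2)^-1 - ((n%:R + 3)^-2 + (n%:R + 3)^-1) =
     ((n%:R + 2) * (n%:R + 3) ^+ 2)^-1 :> rat.
    by field; rewrite ?gt_eqF //; lra.
  by rewrite invr_ge0 mulr_ge0 ?exprn_ge0 //; lra.
by move: IH h; lra.
Qed.

(* Union bound over the common divisors [d >= 2]: the sum of the [1 / d ^ 2]
   is at most [3 / 4]. *)
Lemma coprime_pairs_density (N Z : nat) :
  (N * Z <= 4 * \sum_(1 <= a < N.+1) \sum_(1 <= w < Z.+1) coprime a w)%N.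
Proof.
case: Z => [|Z]; first by rewrite muln0.
set Q := (\sum_(1 <= a < N.+1) _)%N.
(* A pair that is not coprime is counted at its gcd. The range goes one past the largest divisor
   [Z.+1], so that it is never empty and fits [sum_inv_square]. *)
have cover : (N * Z.+1 <= Q + \sum_(2 <= d < Z.+3) (N %/ d) * (Z.+1 %/ d))%N.
  have -> : (\sum_(2 <= d < Z.+3) (N %/ d) * (Z.+1 %/ d) =
     \sum_(1 <= a < N.+1) \sum_(1 <= w < Z.+2) \sum_(2 <= d < Z.+3)
        (d %| a) * (d %| w))%N.
    rewrite [RHS](eq_bigr (fun a => \sum_(2 <= d < Z.+3) \sum_(1 <= w < Z.+2)
        (d %| a) * (d %| w)))%N; last by move=> a _; rewrite exchange_big.
    rewrite [RHS]exchange_big /= big_nat_cond [RHS]big_nat_cond.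
    apply: eq_bigr => d /andP[/andP[d2 _] _].
    have d0 : (0 < d)%N by apply: ltn_trans d2.
    rewrite -(sum_dvdn_index d N) // big_distrl /=; apply: eq_bigr => a _.
    by rewrite -(sum_dvdn_index d Z.+1) // big_distrr.
  rewrite /Q -big_split /=.
  have -> : (N * Z.+1 = \sum_(1 <= a < N.+1) \sum_(1 <= w < Z.+2) 1)%N.
    by rewrite !sum_nat_const_nat !subn1 muln1.
  rewrite big_nat_cond [leqRHS]big_nat_cond.
  apply: leq_sum => a /andP[/andP[a0 _] _]; rewrite -big_split /=.
  rewrite big_nat_cond [leqRHS]big_nat_cond.
  apply: leq_sum => w /andP[/andP[w0 wZ] _].
  have [//|nc] := boolP (coprime a w).
  have g2 : (2 <= gcdn a w)%N by rewrite ltn_neqAle eq_sym nc gcdn_gt0 a0.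
  have gZ : (gcdn a w < Z.+3)%N.
    by apply: (@leq_ltn_trans w); [exact: dvdn_leq (dvdn_gcdr _ _)|apply: ltn_trans wZ _].
  rewrite add0n (bigD1_seq (gcdn a w)) ?iota_uniq //=; last first.
    by rewrite mem_index_iota g2.
  by rewrite dvdn_gcdl dvdn_gcdr.
have : ((N * Z.+1)%:R <= 4 * Q%:R :> rat); last by rewrite -natrM ler_nat.
have sumle : (\sum_(2 <= d < Z.+3) (N %/ d) * (Z.+1 %/ d))%:R <=
    (N * Z.+1)%:R * (3 / 4) :> rat.
  apply: (@le_trans _ _ ((N * Z.+1)%:R * \sum_(2 <= d < Z.+3) (d%:R ^- 2))).
    rewrite natr_sum mulr_sumr big_nat_cond [leRHS]big_nat_cond.
    apply: ler_sum => d /andP[/andP[d2 _] _].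
    have d0 : 0 < d%:R :> rat by rewrite ltr0n (ltn_trans _ d2).
    rewrite ler_pdivlMr ?exprn_gt0 // -natrX -natrM ler_nat.
    by rewrite expnS expn1 mulnACA leq_mul ?leq_trunc_div.
  rewrite ler_wpM2l //; apply: (le_trans (sum_inv_square Z)).
  by rewrite lerBlDr lerDl invr_ge0.
move: cover; rewrite -(ler_nat rat) natrD; move: sumle; lra.
Qed.

Lemma coprime_fraction_inj (m a w a' w' : nat) : (0 < m)%N ->
  (0 < w)%N -> (0 < w')%N -> coprime a w -> coprime a' w' ->
  a%:R / w%:R ^+ m = a'%:R / w'%:R ^+ m :> rat -> (a, w) = (a', w').
Proof.
move=> m0 w0 w'0 c c' e.
have wm : w%:R ^+ m != 0 :> rat by rewrite expf_neq0 // pnatr_eq0 -lt0n.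
have wm' : w'%:R ^+ m != 0 :> rat by rewrite expf_neq0 // pnatr_eq0 -lt0n.
have {}e : (a * w' ^ m = a' * w ^ m)%N.
  apply/eqP; rewrite -(eqr_nat rat) !natrM !natrX; apply/eqP.
  by rewrite -[a%:R](divfK wm) e; field.
have ew : w = w'.
  apply/eqP; rewrite -(eqn_exp2r _ _ m0) eqn_dvd; apply/andP; split.
    rewrite -(@Gauss_dvdr _ a); last by rewrite coprime_sym coprimeXr.
    by rewrite e dvdn_mull.
  rewrite -(@Gauss_dvdr _ a'); last by rewrite coprime_sym coprimeXr.
  by rewrite -e dvdn_mull.
move: e; rewrite ew => /eqP; rewrite eqn_pmul2r ?expn_gt0 ?w'0 // => /eqP -> //.
Qed.

Lemma coprime_fractions (m Z : nat) : (0 < m)%N ->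
  exists s : seq rat, [/\ uniq s, (Z ^ m.+1 <= 4 * size s)%N &
    {in s, forall t, exists a w : nat,
      [/\ t = a%:R / w%:R ^+ m, (0 < w)%N, (w <= Z)%N & (a <= Z ^ m)%N]}].
Proof.
move=> m0.
pose P := [seq (a, w) | a <- index_iota 1 (Z ^ m).+1, w <- index_iota 1 Z.+1].
pose Q := [seq p <- P | coprime p.1 p.2].
have QP p : p \in Q -> [/\ (0 < p.2)%N, (p.2 <= Z)%N, (p.1 <= Z ^ m)%N & coprime p.1 p.2].
  rewrite mem_filter => /andP[c /allpairsP [[a w] /= [ha hw e]]].
  by move: c ha hw; rewrite e /= !mem_index_iota !ltnS => c /andP[_ ->] /andP[-> ->].
exists [seq p.1%:R / p.2%:R ^+ m | p <- Q]; split.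
- rewrite map_inj_in_uniq.
    apply: filter_uniq; apply: allpairs_uniq; rewrite ?iota_uniq //.
    by move=> [a w] [a' w'] _ _.
  move=> [a w] [a' w'] /QP [/= w0 _ _ c] /QP [/= w'0 _ _ c'].
  exact: coprime_fraction_inj.
- rewrite size_map size_filter -sum1_count big_mkcond big_allpairs expnS mulnC.
  apply: (leq_trans (coprime_pairs_density _ _)); rewrite leq_mul2l /=.
  apply: leq_sum => a _; apply: leq_sum => w _ /=.
  by case: coprime.
- move=> t /mapP [[a w] /QP [/= h1 h2 h3 _] ->].
  by exists a, w.
Qed.

(** * Counting isomorphism classes *)

Lemma good_param_mono (f g : {poly rat}) (H H' : nat) (t : rat) :
  (H <= H')%N -> good_param f g H t -> good_param f g H' t.
Proof.
by move=> HH [et [h ht hH]]; split=> //; exists h => //; rewrite (le_trans hH) ?lez_nat.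
Qed.

(** Finiteness is recorded as well, because [fset_set] sends an infinite set to the empty one. *)
Lemma fset_set_le_size (T : choiceType) (A : set T) (s : seq T) :
  (forall x, A x -> x \in s) -> finite_set A /\ (#|` fset_set A| <= size s)%N.
Proof.
move=> As; have fA : finite_set A by apply: (sub_finite_set As); exact: finite_seq.
split=> //; apply: uniq_leq_size; first exact: fset_uniq.
by move=> x; rewrite in_fset_set // inE => /As.
Qed.

Definition good_classes (f g : {poly rat}) (H : nat) : set (set weierstrass) :=
  [set iso_class (family f g t) | t in good_param f g H]%classic.

Lemma good_classes_upper (f g : {poly rat}) (n m K H V W : nat) : (0 < n)%N ->
  (forall t : rat, good_param f g H t -> exists a w : int,
    [/\ t = a%:~R / w%:~R ^+ m,
      (`|w| ^ (12 * n) <= K * H)%N & (`|a| ^ (12 * n) <= K * H ^ m)%N]) ->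
  (K * H < W.+1 ^ (12 * n))%N -> (K * H ^ m < V.+1 ^ (12 * n))%N ->
  finite_set (good_classes f g H) /\
  (#|` fset_set (good_classes f g H)| <= 2 * (V.+1 * W.+1))%N.
Proof.
move=> n0 box hW hV.
(* [L] lists absolute values, and the signs come from its negated copy. The value [w = 0] is
   included because [box] does not exclude it. *)
pose L : seq rat := [seq a%:R / w%:R ^+ m | a <- iota 0 V.+1, w <- iota 0 W.+1].
pose cls t := iso_class (family f g t).
have sL : size (L ++ map -%R L) = (2 * (V.+1 * W.+1))%N.
  by rewrite size_cat size_map size_allpairs !size_iota mul2n addnn.
rewrite -sL -(size_map cls); apply: fset_set_le_size => C [t gt <-].
apply: (map_f cls); have [a [w [et hw ha]]] := box t gt.
have e0 : (0 < 12 * n)%N by rewrite muln_gt0.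
have lw : (`|w| < W.+1)%N by rewrite -(ltn_exp2r _ _ e0) (leq_ltn_trans hw).
have la : (`|a| < V.+1)%N by rewrite -(ltn_exp2r _ _ e0) (leq_ltn_trans ha).
have tL : `|t| \in L.
  apply/allpairsP; exists (`|a|%N, `|w|%N); rewrite !mem_iota /=; split=> //.
  by rewrite et normf_div normrX !natr_absz !intr_norm.
rewrite mem_cat; have [t0|t0] := leP 0 t; first by rewrite -{1}(ger0_norm t0) tL.
by rewrite orbC -[t]opprK map_f // -ltr0_norm.
Qed.

(** The first summand accounts for the singular parameters, the second for the at most boundedly
    many parameters in each class. *)
Lemma good_classes_lower (f g : {poly rat}) (H : nat) (s : seq rat) :
  f != 0 -> g != 0 -> coprimep f g -> (1 < size f)%N \/ (1 < size g)%N ->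
  finite_set (good_classes f g H) -> uniq s ->
  {in s, forall t, elliptic (family f g t) -> good_param f g H t} ->
  (size s <= (size (f ^+ 3)%R + size (g ^+ 2)%R) +
    (size (f ^+ 3)%R + size (g ^+ 2)%R) * #|` fset_set (good_classes f g H)|)%N.
Proof.
move=> f0 g0 cfg sfg fin us hs.
pose ell t := `[< elliptic (family f g t) >].
rewrite -(count_predC ell s) addnC leq_add //.
  rewrite -size_filter; apply: (non_elliptic_bound f g) => //; first exact: filter_uniq.
  by move=> t; rewrite mem_filter => /andP[/= /asboolPn].
rewrite -size_filter.
apply: (@size_le_fibers _ _ (fun t => iso_class (family f g t))).
  move=> t; rewrite mem_filter => /andP[/asboolP et ts].
  by rewrite in_fset_set // inE; exists t => //; exact: hs.
move=> C _; rewrite -size_filter.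
set T := (X in size X).
have hT t : t \in T -> elliptic (family f g t) /\ iso_class (family f g t) = C.
  by rewrite !mem_filter => /andP[/eqP e /andP[/asboolP]].
case eT : T => [//|t0 T']; rewrite -eT.
have [et0 ct0] : elliptic (family f g t0) /\ iso_class (family f g t0) = C.
  by apply: hT; rewrite eT inE eqxx.
apply: (isomorphic_fiber_bound f g t0) => //; first by do 2!apply: filter_uniq.
move=> t /hT [_ ct]; apply: iso_class_inj; by rewrite ct0 ct.
Qed.

Lemma maxr_eq_fraction (r s n m : nat) : (0 < m)%N ->
  Num.max (r%:R / 4) (s%:R / 6) = n%:R / m%:R :> rat ->
  [/\ (r * m <= 4 * n)%N, (s * m <= 6 * n)%N &
      (r * m = 4 * n)%N \/ (s * m = 6 * n)%N].
Proof.
move=> m0 e; have mQ : 0 < m%:R :> rat by rewrite ltr0n.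
have toN (x d : nat) : (0 < d)%N -> x%:R / d%:R = n%:R / m%:R :> rat ->
    (x * m = d * n)%N.
  move=> d0 /eqP; rewrite eqr_div ?pnatr_eq0 -?lt0n // -!natrM eqr_nat => /eqP ->.
  by rewrite mulnC.
have toN_le (x d : nat) : (0 < d)%N -> x%:R / d%:R <= n%:R / m%:R :> rat ->
    (x * m <= d * n)%N.
  move=> d0; rewrite ler_pdivrMr ?ltr0n // mulrAC ler_pdivlMr // -!natrM ler_nat.
  by rewrite [(n * d)%N]mulnC.
have le1 : r%:R / 4 <= n%:R / m%:R :> rat by rewrite -e le_max lexx.
have le2 : s%:R / 6 <= n%:R / m%:R :> rat by rewrite -e le_max lexx orbT.
split; [exact: toN_le le1|exact: toN_le le2|].
by move: e; case: leP => _ e; [right|left]; exact: toN e.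
Qed.

Lemma good_classes_count_bounds (F G : {poly int}) (n m : nat) :
  let f := ratpoly F in let g := ratpoly G in
  f != 0 -> g != 0 -> coprimep f g -> (1 < size f)%N \/ (1 < size g)%N ->
  (0 < n)%N -> (0 < m)%N ->
  ((size f).-1 * m <= 4 * n)%N -> ((size g).-1 * m <= 6 * n)%N ->
  ((size f).-1 * m = 4 * n)%N \/ ((size g).-1 * m = 6 * n)%N ->
  n = 1%N \/ m = 1%N ->
  exists K S k H0 : nat,
    [/\ forall H V W : nat,
          (K * H < W.+1 ^ (12 * n))%N -> (K * H ^ m < V.+1 ^ (12 * n))%N ->
          (#|` fset_set (good_classes f g H)| <= 2 * (V.+1 * W.+1))%N,
        forall H Z : nat, (S * Z ^ (12 * n) <= H)%N ->
          (Z ^ m.+1 <= 4 * (k + k * #|` fset_set (good_classes f g H)|))%N,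
        forall H, (H < H0)%N -> good_classes f g H = set0
      & forall H, (H0 <= H)%N -> (0 < #|` fset_set (good_classes f g H)|)%N].
Proof.
move=> f g f0 g0 cfg sfg n0 m0 hr hs hrs hnm.
have szF : size f = size F by exact: size_rat_int_poly.
have szG : size g = size G by exact: size_rat_int_poly.
have F0 : F != 0 by rewrite -size_poly_gt0 -szF size_poly_gt0.
have G0 : G != 0 by rewrite -size_poly_gt0 -szG size_poly_gt0.
have lF : F`_(size f).-1 != 0 by rewrite szF -lead_coefE lead_coef_eq0.
have lG : G`_(size g).-1 != 0 by rewrite szG -lead_coefE lead_coef_eq0.
have sF : (size F <= (size f).-1.+1)%N by rewrite -szF leqSpred.
have sG : (size G <= (size g).-1.+1)%N by rewrite -szG leqSpred.
(* For [n = 1] the forms have the exact degrees of [f] and [g]. For [m = 1] they are padded to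
   weights [4 * n] and [6 * n], where one top coefficient is still non-zero. *)
have sd : small_denominator f g n m.
  case: hnm => e; rewrite e ?muln1 in hr hs hrs *.
    by apply: (@small_denominator_n1 F G _ _ m cfg m0 sF sG lF lG).
  apply: small_denominator_m1 => //.
  - by apply: leq_trans sF _; rewrite ltnS.
  - by apply: leq_trans sG _; rewrite ltnS.
  - by case: hrs => <-; [left|right].
have [c c0 hc] := coprime_horner_growth f g n m cfg m0 hrs f0 g0.
have [K hK] := good_param_box f g n m c m0 sd c0 hc.
have [S hS] := good_param_fraction F G _ _ n m sF sG hr hs.
pose k := (size (f ^+ 3)%R + size (g ^+ 2)%R)%N.
have fin H : finite_set (good_classes f g H).
  pose W := (K * H)%N; pose V := (K * H ^ m)%N.
  have e0 : (0 < 12 * n)%N by rewrite muln_gt0.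
  have big x : (x < x.+1 ^ (12 * n))%N.
    by rewrite -{1}[x.+1]expn1 leq_pexp2l.
  by have [] := good_classes_upper f g n m K H V W n0 (hK H) (big _) (big _).
have ex : exists H, `[< good_classes f g H !=set0 >]%classic.
  (* The integers [0] to [k] cannot all give singular curves, being more than the bound on the
     number of singular parameters. *)
  have [nell|] := pselect (forall a : nat, ~ elliptic (family f g a%:R)).
    have us : uniq [seq a%:R : rat | a <- iota 0 k.+1].
      by rewrite map_inj_uniq ?iota_uniq //; exact: mulrIn (oner_neq0 _).
    have := non_elliptic_bound f g _ f0 g0 cfg sfg us.
    rewrite size_map size_iota -/k ltnn => bad; suff : false by [].
    by apply: bad => t /mapP [a _ ->]; exact: nell.
  move=> /existsNP [a /contrapT ea].
  exists (S * a.+1 ^ (12 * n))%N; apply/asboolP.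
  have := hS a.+1 a 1%N isT isT; rewrite /= expr1n divr1 => h.
  exists (iso_class (family f g a%:R)); exists a%:R => //; apply: h => //.
  by rewrite (leq_trans (leqnSn a)) // -{1}[a.+1]expn1 leq_pexp2l.
(* [H0] is the least height occurring in the family. *)
case: (ex_minnP ex) => H0 /asboolP [C [t gt _]] minH.
exists K, S, k, H0; split.
- move=> H V W hW hV.
  by have [] := good_classes_upper f g n m K H V W n0 (hK H) hW hV.
- move=> H Z hH; have [s [us ss hs']] := coprime_fractions m Z m0.
  apply: (leq_trans ss); rewrite leq_mul2l /=.
  apply: good_classes_lower => // x /hs' [a [w [-> w0 wZ aZ]]] ex'.
  by apply: good_param_mono hH _; exact: hS.
- move=> H HH0; apply/eqP/negPn/negP => /set0P ne.
  have := minH H; rewrite leqNgt HH0 => /(_ _)/negP; apply => //; exact/asboolP.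
- move=> H HH0; rewrite cardfs_gt0; apply/fset0Pn.
  exists (iso_class (family f g t)); rewrite in_fset_set // inE.
  by exists t => //; exact: good_param_mono HH0 gt.
Qed.

(** * From natural number bounds to real powers *)

(** With [y = X ^ (1 / e)], the lower bound takes [Z] of order [y], and the upper bound takes [W] of
    order [y] and [V] of order [y ^ m]. From [H0] on the count is at least 1, which absorbs the
    additive constants. *)
Lemma counting_power_bounds (R : realType) (N : nat -> nat) (e m K S k H0 : nat) :
  (0 < e)%N ->
  (forall H V W : nat, (K * H < W.+1 ^ e)%N -> (K * H ^ m < V.+1 ^ e)%N ->
     (N H <= 2 * (V.+1 * W.+1))%N) ->
  (forall H Z : nat, (S * Z ^ e <= H)%N -> (Z ^ m.+1 <= 4 * (k + k * N H))%N) ->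
  (forall H, (H < H0)%N -> N H = 0%N) ->
  (forall H, (H0 <= H)%N -> (0 < N H)%N) ->
  exists K1 K2 X0 : R,
    [/\ 0 < K1, 0 < K2, 1 <= X0,
        forall X : R, 1 <= X -> X < X0 -> N (Num.truncn X) = 0%N
      & forall X : R, X0 <= X ->
          K1 * X `^ (m.+1%:R / e%:R) <= (N (Num.truncn X))%:R
            <= K2 * X `^ (m.+1%:R / e%:R)].
Proof.
move=> e0 up low zero pos.
have le_succ_exp (x : nat) : (x <= x.+1 ^ e)%N.
  by apply: leq_trans (leqnSn x) _; rewrite -[leqLHS]expn1 leq_pexp2l.
pose S1 := S.+1; pose K1 := K.+1.
(* The factor [(2 * S1) ^ m.+1] comes from [y < (Z + 1) S1] and from replacing [Z + 1] by [Z]. The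
   factor [8 * k + 1] comes from [4 (k + k N) + 1 <= (8 k + 1) N] for [N >= 1]. *)
pose c : R := ((2 * S1) ^ m.+1 * (8 * k + 1))%:R.
have c0 : 0 < c by rewrite ltr0n muln_gt0 expn_gt0 muln_gt0 addn1.
exists c^-1, (8 * K1%:R ^+ 2), (Num.max 1 H0%:R).
split; [by rewrite invr_gt0|by rewrite mulr_gt0 ?exprn_gt0 ?ltr0n|by rewrite le_max lexx| |].
  move=> X X1; rewrite lt_max ltNge X1 /= => XH; apply: zero.
  by rewrite truncn_lt_nat // (le_trans ler01).
move=> X; rewrite ge_max => /andP[X1 XH].
have X0 : 0 <= X by apply: le_trans X1.
have HN : (0 < N (Num.truncn X))%N by apply: pos; rewrite truncn_ge_nat.
set H := Num.truncn X in HN *.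
have HX : H%:R <= X by rewrite truncn_le.
pose y := X `^ (e%:R^-1).
have y0 : 0 <= y by apply: powR_ge0.
have ye : y ^+ e = X.
  by rewrite /y -powR_mulrn ?powR_ge0 // -powRrM mulVf ?powRr1 // pnatr_eq0 -lt0n.
have y1 : 1 <= y.
  by rewrite -(expr_ge1 e0) ?ye.
have -> : X `^ (m.+1%:R / e%:R) = y ^+ m.+1.
  by rewrite mulrC powRrM powR_mulrn ?powR_ge0.
apply/andP; split.
  pose Z := Num.truncn (y / S1%:R).
  have S0 : 0 < S1%:R :> R by rewrite ltr0n.
  have yS : 0 <= y / S1%:R by rewrite divr_ge0.
  have Zle : Z%:R * S1%:R <= y by rewrite -ler_pdivlMr // truncn_le.
  have Zgt : y < Z.+1%:R * S1%:R by rewrite -ltr_pdivrMr // truncnS_gt.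
  have SH : (S * Z ^ e <= H)%N.
    rewrite truncn_ge_nat // -ye.
    apply: le_trans (_ : (Z%:R * S1%:R) ^+ e <= _); last first.
      by rewrite lerXn2r ?nnegrE ?mulr_ge0.
    by rewrite -natrM -natrX ler_nat expnMn mulnC leq_mul2l le_succ_exp orbT.
  have hZ := low _ _ SH.
  (* The summand 1 on the right covers [Z = 0]. *)
  have Z2 : (Z.+1 ^ m.+1 <= 2 ^ m.+1 * (Z ^ m.+1 + 1))%N.
    case: (Z) => [|z]; first by rewrite exp1n muln_gt0 expn_gt0 addn1.
    apply: (@leq_trans ((2 * z.+1) ^ m.+1)).
      by rewrite leq_exp2r // mul2n -addnn addSn addnS ltnS -addSn leq_addr.
    by rewrite expnMn leq_mul2l leq_addr orbT.
  rewrite mulrC ler_pdivrMr //.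
  apply: (@le_trans _ _ ((Z.+1 * S1) ^ m.+1)%:R).
    rewrite natrX natrM lerXn2r ?nnegrE ?mulr_ge0 //; exact: ltW.
  rewrite /c -natrM ler_nat expnMn.
  apply: (leq_trans (leq_mul Z2 (leqnn _))).
  rewrite mulnAC -expnMn mulnCA leq_mul2l; apply/orP; right.
  have kN : (k <= k * N H)%N by rewrite leq_pmulr.
  have -> : (N H * (8 * k + 1) = 8 * (k * N H) + N H)%N.
    by rewrite mulnDr muln1 mulnCA [(N H * k)%N]mulnC.
  move: hZ HN kN; move: (Z ^ m.+1)%N (k * N H)%N (N H) => p q r; lia.
have K1y x : 1 <= x -> 1 <= K1%:R * x :> R.
  by move=> x1; rewrite mulr_ege1 ?(ler_nat _ 1).
have large (x : R) (v h : nat) : 1 <= x -> h%:R <= x ^+ e ->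
    v = Num.truncn (K1%:R * x) -> (K * h < v.+1 ^ e)%N.
  move=> x1 hx ->; rewrite -(ltr_nat R).
  apply: (@le_lt_trans _ _ ((K1%:R * x) ^+ e)); last first.
    rewrite natrX ltrXn2r -?lt0n //; last exact: truncnS_gt.
    by rewrite (le_trans ler01) ?K1y.
  by rewrite natrM exprMn ler_pM // -natrX ler_nat le_succ_exp.
have ym1 : 1 <= y ^+ m by apply: exprn_ege1.
pose W := Num.truncn (K1%:R * y); pose V := Num.truncn (K1%:R * y ^+ m).
have hW : (K * H < W.+1 ^ e)%N by apply: (large y) => //; rewrite ye.
have hV : (K * H ^ m < V.+1 ^ e)%N.
  apply: (large (y ^+ m)) => //; rewrite -exprM mulnC exprM ye natrX.
  by rewrite lerXn2r ?nnegrE.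
have succ_le (x : R) : 1 <= x -> (Num.truncn x).+1%:R <= 2 * x.
  move=> x1; rewrite -natr1 mulr_natl mulr2n lerD // truncn_le.
  by rewrite (le_trans ler01).
have := up H V W hW hV; rewrite -(ler_nat R) => /le_trans; apply.
rewrite natrM [(V.+1 * _)%:R]natrM.
(* Rounding costs a factor 2 for each of [V] and [W], whence the constant [8 * K1 ^ 2]. *)
apply: (@le_trans _ _ (2 * ((2 * (K1%:R * y ^+ m)) * (2 * (K1%:R * y))))).
  by rewrite ler_wpM2l // ler_pM ?succ_le ?K1y.
by rewrite [y ^+ m.+1]exprS le_eqVlt; apply/orP; left; apply/eqP; ring.
Qed.

(** A positive lower bound fails wherever the count is zero, as it is below the least height in the
    family. The threshold [X0] separates this range from the one where both bounds hold. *)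
Theorem theorem1p6 (R : realType) (f g : {poly rat}) (r s n m : nat)
  (hf : f != 0) (hg : g != 0) (hfg : coprimep f g)
  (hr : r = (size f).-1) (hs : s = (size g).-1)
  (hrs : (0 < r)%N \/ (0 < s)%N)
  (hn : (0 < n)%N) (hm : (0 < m)%N) (hnm : coprime n m)
  (hmax : Num.max (r%:R / 4) (s%:R / 6) = n%:R / m%:R :> rat)
  (hnm1 : n = 1%N \/ m = 1%N) :
  exists K1 K2 X0 : R,
    [/\ 0 < K1, 0 < K2, 1 <= X0,
        forall X : R, 1 <= X -> X < X0 -> family_count f g X = 0%N
      & forall X : R, X0 <= X ->
          K1 * X `^ (m.+1%:R / (12 * n)%:R) <= (family_count f g X)%:R
            <= K2 * X `^ (m.+1%:R / (12 * n)%:R)].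
Proof.
(* The scaled integral family has the same classes, and scaling preserves degrees and
   coprimality. *)
have [c [F [G [c0 eF eG]]]] := clear_denominators f g.
have c4 : c ^+ 4 != 0 by rewrite expf_neq0.
have c6 : c ^+ 6 != 0 by rewrite expf_neq0.
have sF : size (ratpoly F) = size f by rewrite -eF size_scale.
have sG : size (ratpoly G) = size g by rewrite -eG size_scale.
have F0 : ratpoly F != 0 by rewrite -eF scaler_eq0 negb_or c4.
have G0 : ratpoly G != 0 by rewrite -eG scaler_eq0 negb_or c6.
have cFG : coprimep (ratpoly F) (ratpoly G) by rewrite -eF -eG coprimepZl ?coprimepZr.
have [rm sm rsm] := maxr_eq_fraction r s n m hm hmax.
have large : (1 < size (ratpoly F))%N \/ (1 < size (ratpoly G))%N.
  by rewrite sF sG; move: hrs; rewrite hr hs -!subn1 !subn_gt0.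
rewrite hr hs -sF -sG in rm sm rsm.
have [K [S [k [H0 [up low zero pos]]]]] :=
  good_classes_count_bounds F G n m F0 G0 cFG large hn hm rm sm rsm hnm1.
have zero' H : (H < H0)%N ->
    #|` fset_set (good_classes (ratpoly F) (ratpoly G) H)| = 0%N.
  by move=> /zero ->; rewrite fset_set0 cardfs0.
have e0 : (0 < 12 * n)%N by rewrite muln_gt0.
have [K1 [K2 [X0 [K10 K20 X01 small bounds]]]] :=
  counting_power_bounds R _ _ _ _ _ _ _ e0 up low zero' pos.
have countE (X : R) : 1 <= X -> family_count f g X =
    #|` fset_set (good_classes (ratpoly F) (ratpoly G) (Num.truncn X))|.
  move=> X1; rewrite /family_count -(family_classes_scale _ _ _ _ _ c0) eF eG.
  by rewrite family_classesE // (le_trans ler01).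
exists K1, K2, X0; split=> // X hX; first by move=> XX0; rewrite countE // small.
by rewrite countE ?bounds // (le_trans X01).
Qed.
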